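(* Let $\Gamma$ be a connected quiver of reduced rank one containing a cycle of length $2$, with vertices $1,\ldots,n$, where $1,2$ are the vertices of the cycle and $\alpha_1:1\to2$, $\alpha_2:2\to1$ are its arrows. Let $A=K^m$. Data $\mathcal{D}(u,a)$ defines a splitted, unital and factorizable representation of $\Gamma$ over $A$ if, and only if, for every arrow $\alpha\in\Gamma^1\setminus\{\alpha_1,\alpha_2\}$ that is not a loop and every $p\in\{1,\ldots,m\}$ such that $u_{s(\alpha)}(p)\neq p$ and $u_{t(\alpha)}(p)\neq p$, one of the following conditions holds: (1) $s(\alpha)=1$ and $a_p=1$. (2) $s(\alpha)=2$ and $a_p=0$.
   Context: $K$ is a field; $K^m$ is the product algebra with canonical basis $\{f_1,\ldots,f_m\}$ and dual basis $\{f_1^*,\dots,f_m^*\}$. A quiver $\Gamma$ has a vertex set $\Gamma^0$, an arrow set $\Gamma^1$, and source and target maps $s,t$. $\Gamma^1(i,j)$ is the set of arrows from $i$ to $j$; $\Gamma^2(i,j)$ is the set of pairs $(\alpha_1,\alpha_2)$ of arrows with $s(\alpha_1)=i$, $t(\alpha_1)=s(\alpha_2)$, $t(\alpha_2)=j$. $\Gamma$ is finite, has no multiple arrows, and every vertex carries a unique loop; connected means that the underlying undirected graph is connected. A cycle of length $2$ consists of two distinct vertices with arrows in both directions. The reduced rank of $\Gamma$ is the maximum over $i\in\Gamma^0$ of $\mathrm{rrank}(i)=\#\{\alpha\in\Gamma^1\mid t(\alpha)=i,\ s(\alpha)\neq i\}$. A representation of $\Gamma$ over $A$ is a family $(\varphi_\alpha)_{\alpha\in\Gamma^1}$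 of $K$-linear maps $A\to A$ (the vector space at every vertex is $A$); $\varphi_i$ denotes the map attached to the loop at $i$. It is: splitted if for every vertex $i$ and all arrows $\alpha',\alpha''$ with target $i$, $\varphi_{\alpha'}\circ\varphi_{\alpha''}=\delta_{s(\alpha'),s(\alpha'')}\varphi_{\alpha'}$, and $\sum_{t(\alpha)=i}\varphi_\alpha=\mathrm{Id}_A$; unital if $\varphi_\alpha(1_A)=\delta_{s(\alpha),t(\alpha)}1_A$ for every arrow $\alpha$; factorizable if for all vertices $i,j$ and $a,b\in A$, $\sum_{(\beta_1,\beta_2)\in\Gamma^2(i,j)}\varphi_{\beta_1}(a)\varphi_{\beta_2}(b)$ equals $\varphi_\alpha(ab)$ if $\Gamma^1(i,j)=\{\alpha\}$, and $0$ if $\Gamma^1(i,j)=\emptyset$. Data $\mathcal{D}(u,a)$ consists of: maps $u_1,\ldots,u_n:\{1,\ldots,m\}\to\{1,\ldots,m\}$ with $u_1=u_2=u$ and $u_i$ idempotent ($u_i\circ u_i=u_i$) for each $i\geq3$; and elements $a_1,\ldots,a_m\in K$ such that for every $p$: if $u(p)=p$ then $a_p=0$; if $u(p)\neq p$ then $a_p+a_{u(p)}=1$, and if in addition $u^2(p)\neq p$ then $a_p\in\{0,1\}$. The family of maps defined by $\mathcal{D}(u,a)$ is: $\varphi_1(x)=\sum_{p}[a_pf_p^*(x)+(1-a_p)f_{u(p)}^*(x)]f_p$, $\varphi_{\alpha_1}(x)=\sum_{p}a_p[f_p^*(x)-f_{u(p)}^*(x)]f_p$, $\varphi_2(x)=\sum_{p}[(1-a_p)f_p^*(x)+a_pf_{u(p)}^*(x)]f_p$,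 $\varphi_{\alpha_2}(x)=\sum_{p}(1-a_p)[f_p^*(x)-f_{u(p)}^*(x)]f_p$; for $i\geq3$, $\varphi_i(f_p)=\sum_{q=1}^m\delta_{p,u_i(q)}f_q$; and $\varphi_\alpha=\mathrm{Id}_A-\varphi_{t(\alpha)}$ for every arrow $\alpha\notin\{\alpha_1,\alpha_2\}$ that is not a loop. *)

(* Defs.v *)
From mathcomp Require Import all_boot all_order all_algebra.

Set Implicit Arguments.
Unset Strict Implicit.
Unset Printing Implicit Defensive.

Import GRing.Theory.
Local Open Scope ring_scope.

Record quiver := Quiver {
  vertex : finType;
  arrow : finType;
  src : arrow -> vertex;
  tgt : arrow -> vertex }.

Section QuiverNotions.
Variable G : quiver.
Implicit Types i j : vertex G.

Definition arrows i j : {set arrow G} :=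
  [set al | (src al == i) && (tgt al == j)].

Definition paths2 i j : {set arrow G * arrow G} :=
  [set be | [&& src be.1 == i, tgt be.1 == src be.2 & tgt be.2 == j]].

Definition is_loop (al : arrow G) : bool := src al == tgt al.

Definition no_multiple_arrows : Prop := forall i j, (#|arrows i j| <= 1)%N.

Definition unique_loops : Prop := forall i, #|arrows i i| = 1%N.

Definition adjacent : rel (vertex G) :=
  [rel i j | (arrows i j != set0) || (arrows j i != set0)].

Definition connected_quiver : Prop := forall i j, connect adjacent i j.

Definition rrank i : nat := #|[set al : arrow G | (tgt al == i) && (src al != i)]|.

Definition reduced_rank : nat := \max_(i : vertex G) rrank i.

Definition two_cycle (v1 v2 : vertex G) (al1 al2 : arrow G) : Prop :=
  [/\ v1 != v2, al1 \in arrows v1 v2 & al2 \in arrows v2 v1].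

End QuiverNotions.

Section Representations.
Variable G : quiver.

(* A representation whose vector space at every vertex is A is a family of    *)
(* functions A -> A satisfying this predicate.                                *)
Definition representation (K : fieldType) (A : lmodType K)
    (phi : arrow G -> A -> A) : Prop :=
  forall al, linear (phi al).

Definition splitted (A : zmodType) (phi : arrow G -> A -> A) : Prop :=
  forall i : vertex G,
    (forall al' al'' : arrow G, tgt al' = i -> tgt al'' = i ->
       forall x, phi al' (phi al'' x) = phi al' x *+ (src al' == src al''))
    /\ (forall x, \sum_(al | tgt al == i) phi al x = x).

(* pzRingType rather than algType: the latter excludes the zero algebra K^0. *)
Definition unital (A : pzRingType) (phi : arrow G -> A -> A) : Prop :=
  forall al, phi al 1 = (src al == tgt al)%:R.

Definition factorizable (A : pzRingType) (phi : arrow G -> A -> A) : Prop :=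
  forall (i j : vertex G) (a b : A),
    let S := \sum_(be in paths2 i j) phi be.1 a * phi be.2 b in
    (forall al, arrows i j = [set al] -> S = phi al (a * b))
    /\ (arrows i j = set0 -> S = 0).

End Representations.

(* The product algebra K^m; with K^o rather than K the library finds both its *)
(* product ring structure and its K-module structure.                         *)
Notation "K ^^ m" := {ffun 'I_m -> K^o}
  (at level 30, m at next level, only parsing) : type_scope.

Section Data.
Variables (K : fieldType) (m : nat) (G : quiver).
Variables (v1 v2 : vertex G) (al1 al2 : arrow G).
Variables (u : vertex G -> 'I_m -> 'I_m) (a : 'I_m -> K).

(* v1 and v2 are the vertices 1 and 2; the map called u in D(u,a) is u v1. *)
Definition is_data : Prop :=
  [/\ u v1 =1 u v2,
      forall i, i != v1 -> i != v2 -> forall p, u i (u i p) = u i p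
    & forall p,
        [/\ u v1 p = p -> a p = 0,
            u v1 p != p -> a p + a (u v1 p) = 1
          & u v1 p != p -> u v1 (u v1 p) != p -> a p = 0 \/ a p = 1]].

Definition fbasis (p : 'I_m) : K ^^ m := [ffun q => (p == q)%:R].
Definition fdual (p : 'I_m) (x : K ^^ m) : K := x p.

Implicit Type x : K ^^ m.

Definition phi_1 x :=
  \sum_p (a p * fdual p x + (1 - a p) * fdual (u v1 p) x) *: fbasis p.

Definition phi_al1 x :=
  \sum_p (a p * (fdual p x - fdual (u v1 p) x)) *: fbasis p.

Definition phi_2 x :=
  \sum_p ((1 - a p) * fdual p x + a p * fdual (u v1 p) x) *: fbasis p.

Definition phi_al2 x :=
  \sum_p ((1 - a p) * (fdual p x - fdual (u v1 p) x)) *: fbasis p.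

(* Linear extension of f_p |-> sum_q delta_(p, u_i(q)) f_q. *)
Definition phi_ge3 (i : vertex G) x :=
  \sum_p fdual p x *: (\sum_q (p == u i q)%:R *: fbasis q).

Definition phi_vertex (i : vertex G) x :=
  if i == v1 then phi_1 x else if i == v2 then phi_2 x else phi_ge3 i x.

Definition phi_data (al : arrow G) x :=
  if is_loop al then phi_vertex (tgt al) x
  else if al == al1 then phi_al1 x
  else if al == al2 then phi_al2 x
  else x - phi_vertex (tgt al) x.

End Data.

(* Main.v *)
Require Import Defs.
From mathcomp Require Import all_boot all_order all_algebra.
From mathcomp Require Import ring.

Set Implicit Arguments.
Unset Strict Implicit.
Unset Printing Implicit Defensive.

Import GRing.Theory.
Local Open Scope ring_scope.

(** In a connected quiver of reduced rank one with a 2-cycle, every vertex [j]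
    receives exactly two arrows: its loop and one arrow from a vertex [pre j].
    Moreover [phi] sends the loop to [phi_j] and the other arrow to
    [Id - phi_j], where [phi_j x p = c_j p * x p + (1 - c_j p) * x (u_j p)] with
    [c_j = a], [1 - a] or [0] according to whether [j] is 1, 2 or another vertex.
    The data always give a splitted and unital representation, and the
    factorization identities ending at 1 or 2 always hold.  At any other [j],
    where [phi_j] is multiplicative, all of them amount to
    [(x - phi_(pre j) x) * (y - phi_j y) = 0] for all [x] and [y], which is the
    condition of the theorem read coordinatewise. *)

(** With [x' = f j x], [x'' = f k x], [y' = f j y] and [f j] multiplicative, the right side is the
    defect of the factorization identity for an arrow from [k] to [j]. *)
Lemma mul_correctionsE (A : pzRingType) (x y x' x'' y' : A) :
  (x - x'') * (y - y') = x * y - x' * y' - ((x - x') * y' + x'' * (y - y')).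
Proof.
by rewrite !mulrBl !mulrBr [in RHS]opprD addrA; congr (_ - _);
  rewrite opprB addrA subrK.
Qed.

(** * Arrows entering a vertex *)

Section IncomingArrows.
Variable G : quiver.
Implicit Types (al be : arrow G) (i j : vertex G).

Lemma eq_incoming al be :
  (reduced_rank G <= 1)%N -> tgt al = tgt be ->
  ~~ is_loop al -> ~~ is_loop be -> al = be.
Proof.
move=> hrank e nal nbe.
have /card_le1_eqP : (rrank (tgt al) <= 1)%N.
  by apply: leq_trans hrank; apply: leq_bigmax.
by apply; rewrite !inE ?e ?eqxx //= -?e.
Qed.

Lemma eq_loop al be :
  unique_loops G -> tgt al = tgt be -> is_loop al -> is_loop be -> al = be.
Proof.
move=> hloops e /eqP lal /eqP lbe.
have /card_le1_eqP : (#|arrows (tgt al) (tgt al)| <= 1)%N by rewrite hloops.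
by apply; rewrite !inE ?lal ?lbe ?e eqxx.
Qed.

(** Every vertex is reached from [v1] by a directed path of non-loop arrows, whose last arrow enters
    it; the empty path ends at [v1], which [al2] enters. *)
Lemma incoming_exists v1 v2 al1 al2 :
  connected_quiver G -> (reduced_rank G <= 1)%N ->
  @two_cycle G v1 v2 al1 al2 ->
  forall j, exists be, tgt be = j /\ ~~ is_loop be.
Proof.
move=> hconn hrank [n12].
rewrite !inE => /andP[/eqP s1 /eqP t1] /andP[/eqP s2 /eqP t2] j.
have nal2 : ~~ is_loop al2 by rewrite /is_loop s2 t2 eq_sym.
have nal1 : ~~ is_loop al1 by rewrite /is_loop s1 t1.
pose e : rel (vertex G) :=
  [rel i k | [exists be, [&& src be == i, tgt be == k & ~~ is_loop be]]].
have edge be : ~~ is_loop be -> e (src be) (tgt be).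
  by move=> nbe; apply/existsP; exists be; rewrite !eqxx.
have last_step k : connect e v1 k ->
    k = v1 \/ exists be, [/\ connect e v1 (src be), tgt be = k & ~~ is_loop be].
  case/connectP=> p; case/lastP: p => [|p x] /=; first by left.
  rewrite rcons_path last_rcons => /andP[ep /existsP[be]].
  case/and3P=> /eqP sb /eqP tb nb ->.
  by right; exists be; split=> //; rewrite sb; apply/connectP; exists p.
(* The descendants of [v1] are closed under going backwards along an arrow,
   because a vertex has a single predecessor and that of [v1] is [v2]. *)
have reach : connect e v1 j.
  move: (hconn v1 j) => /connectP[p + ->] {j}.
  elim/last_ind: p => [|p y IHp] /=; first by rewrite connect0.
  rewrite rcons_path last_rcons => /andP[/IHp {IHp}].
  move: (last v1 p) => x cx adj.
  have [<-//|nxy] := eqVneq x y.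
  case/orP: adj => /set0Pn[be]; rewrite inE => /andP[/eqP sb /eqP tb].
    apply: (connect_trans cx); apply/connect1; rewrite -sb -tb edge //.
    by rewrite /is_loop sb tb.
  have nbe : ~~ is_loop be by rewrite /is_loop sb tb eq_sym.
  have [xv1|[ga [cga tga nga]]] := last_step _ cx; last first.
    by rewrite -sb (eq_incoming hrank _ nbe nga) // tb.
  rewrite -sb (eq_incoming hrank _ nbe nal2) ?tb ?t2 // s2 -t1 -s1.
  exact/connect1/edge.
by have [->|[be [_ tb nb]]] := last_step _ reach; [exists al2 | exists be].
Qed.

End IncomingArrows.

(** * Representations when each vertex has two incoming arrows *)

Section TwoIncoming.
Variables (G : quiver) (lp inn : vertex G -> arrow G).
Hypothesis incomingE :
  forall j al, (tgt al == j) = (al == lp j) || (al == inn j).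
Hypothesis src_lp : forall j, src (lp j) = j.
Hypothesis src_inn : forall j, src (inn j) != j.

Let tgt_lp j : tgt (lp j) = j.
Proof. by apply/eqP; rewrite incomingE eqxx. Qed.

Let tgt_inn j : tgt (inn j) = j.
Proof. by apply/eqP; rewrite incomingE eqxx orbT. Qed.

Let inn_lp j : inn j != lp j.
Proof. by apply: contraNneq (src_inn j) => ->; rewrite src_lp. Qed.

Lemma sum_incoming (V : nmodType) (F : arrow G -> V) j :
  \sum_(al | tgt al == j) F al = F (lp j) + F (inn j).
Proof.
rewrite (bigD1 (lp j)) ?tgt_lp //= (big_pred1 (inn j)) // => al /=.
rewrite incomingE; have [->|_] := eqVneq al (lp j); last by rewrite /= andbT.
by rewrite andbF eq_sym (negPf (inn_lp j)).
Qed.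

(** The second arrow of a path ending at [j] is [lp j] or [inn j], and its source again has two
    incoming arrows: four candidates, kept when they start at [i]. *)
Lemma sum_paths2 (V : nmodType) (F : arrow G -> arrow G -> V) i j :
  \sum_(be in paths2 i j) F be.1 be.2 =
    F (lp j) (lp j) *+ (j == i) + F (inn j) (lp j) *+ (src (inn j) == i)
    + (F (lp (src (inn j))) (inn j) *+ (src (inn j) == i)
       + F (inn (src (inn j))) (inn j) *+ (src (inn (src (inn j))) == i)).
Proof.
transitivity (\sum_(be2 | tgt be2 == j) \sum_(be1 | tgt be1 == src be2)
                F be1 be2 *+ (src be1 == i)).
  rewrite (exchange_big_dep predT) //= pair_big_dep /=.
  rewrite [RHS]big_mkcond [LHS]big_mkcond.
  apply: eq_bigr => -[b1 b2] _ /=; rewrite inE /= andbC.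
  by case: (src b1 == i); rewrite ?andbF ?mulr0n ?if_same // andbT andbC.
by rewrite sum_incoming !sum_incoming !src_lp.
Qed.

Lemma arrows_lp j : arrows j j = [set lp j].
Proof.
apply/setP=> al; rewrite !inE incomingE andb_orr.
have [->|_] := eqVneq al (lp j); first by rewrite src_lp eqxx.
rewrite andbF /=; case: (eqVneq al (inn j)) => [->|]; rewrite ?andbF //.
by rewrite (negPf (src_inn j)).
Qed.

Lemma arrows_inn j : arrows (src (inn j)) j = [set inn j].
Proof.
apply/setP=> al; rewrite !inE incomingE andb_orr.
have [->|_] := eqVneq al (inn j); first by rewrite eqxx orbT.
rewrite andbF orbF; case: (eqVneq al (lp j)) => [->|]; rewrite ?andbF //.
by rewrite src_lp eq_sym (negPf (src_inn j)).
Qed.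

Lemma arrows_eq0 i j : j != i -> src (inn j) != i -> arrows i j = set0.
Proof.
move=> nji npi; apply/setP=> al; rewrite !inE incomingE.
apply/negP => /andP[/eqP sal /orP[]/eqP eal]; move: sal; rewrite eal ?src_lp.
  exact/eqP.
exact/eqP.
Qed.

Section Maps.
Variables (A : pzRingType) (phi : arrow G -> A -> A) (f : vertex G -> A -> A).
Hypothesis phi_lp : forall j x, phi (lp j) x = f j x.
Hypothesis phi_inn : forall j x, phi (inn j) x = x - f j x.

(** As [src (inn j) != j], at most one multiplicity on the right is nonzero, so one equation covers
    a loop, a non-loop arrow and no arrow. *)
Lemma factorizableP :
  factorizable phi <-> forall i j x y,
    (f j x * f j y) *+ (j == i) + ((x - f j x) * f j y) *+ (src (inn j) == i)
    + ((f (src (inn j)) x * (y - f j y)) *+ (src (inn j) == i)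
       + ((x - f (src (inn j)) x) * (y - f j y)) *+ (src (inn (src (inn j))) == i))
    = f j (x * y) *+ (j == i) + (x * y - f j (x * y)) *+ (src (inn j) == i).
Proof.
split=> [hf i j x y|hf i j x y /=].
  have /= := hf i j x y; rewrite (sum_paths2 (fun b1 b2 => phi b1 x * phi b2 y)).
  rewrite !phi_lp !phi_inn.
  have [<-|nji] := eqVneq j i.
    rewrite (negPf (src_inn j)) addr0; case=> /(_ _ (arrows_lp j)) -> _.
    by rewrite phi_lp addr0.
  have [<-|npi] := eqVneq (src (inn j)) i.
    by rewrite add0r; case=> /(_ _ (arrows_inn j)) -> _; rewrite phi_inn add0r.
  by rewrite (arrows_eq0 nji npi); case=> _ -> //; rewrite addr0.
rewrite (sum_paths2 (fun b1 b2 => phi b1 x * phi b2 y)) !phi_lp !phi_inn hf.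
have [<-|nji] := eqVneq j i.
  rewrite (negPf (src_inn j)) addr0 arrows_lp; split=> [al /set1_inj <-|].
    by rewrite phi_lp.
  by move=> /setP/(_ (lp j)); rewrite !inE eqxx.
have [<-|npi] := eqVneq (src (inn j)) i.
  rewrite add0r arrows_inn; split=> [al /set1_inj <-|]; first by rewrite phi_inn.
  by move=> /setP/(_ (inn j)); rewrite !inE eqxx.
rewrite (arrows_eq0 nji npi) addr0; split=> // al.
by move=> /setP/(_ al); rewrite !inE eqxx.
Qed.

(** [f j] and [Id - f j] are complementary idempotents. *)
Lemma splitted_idem :
  (forall j, {morph f j : x y / x - y}) -> (forall j x, f j (f j x) = f j x) ->
  splitted phi.
Proof.
move=> fB ff j; split=> [al be /eqP + /eqP + x|x]; last first.
  by rewrite sum_incoming phi_lp phi_inn addrC subrK.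
rewrite !incomingE => /orP[]/eqP-> /orP[]/eqP->;
  rewrite ?src_lp ?eqxx ?(negPf (src_inn j)) 1?[j == _]eq_sym ?(negPf (src_inn j));
  by rewrite !(phi_lp, phi_inn) ?fB ?ff ?subrr ?subr0.
Qed.

Lemma unital_fix : (forall j, f j 1 = 1) -> unital phi.
Proof.
move=> f1 al; have /esym := incomingE (tgt al) al; rewrite eqxx => /orP[]/eqP e.
  by rewrite {1 2}e phi_lp f1 src_lp eqxx.
by rewrite {1 2}e phi_inn f1 subrr (negPf (src_inn _)).
Qed.

End Maps.
End TwoIncoming.

(** * The maps attached to the vertices *)

Section VertexMaps.
Variables (K : fieldType) (m : nat) (G : quiver) (v1 v2 : vertex G).
Variables (u : vertex G -> 'I_m -> 'I_m) (a : 'I_m -> K).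
Hypothesis n12 : v1 != v2.
Hypothesis hdata : is_data v1 v2 u a.
Implicit Types (x y : K ^^ m) (j : vertex G) (p : 'I_m).

Let f : vertex G -> K ^^ m -> K ^^ m := phi_vertex v1 v2 u a.

(** The coefficient [c_j], which brings the three formulas for [phi_j] into one. *)
Definition own_weight j p : K :=
  if j == v1 then a p else if j == v2 then 1 - a p else 0.

Lemma sum_fbasis (F : 'I_m -> K) p : (\sum_q F q *: fbasis K q) p = F p.
Proof.
rewrite sum_ffunE (bigD1 p) //= big1 => [|q npq]; rewrite !ffunE.
  by rewrite eqxx addr0 /GRing.scale /= mulr1.
by rewrite (negPf npq) /GRing.scale /= mulr0.
Qed.

Lemma phi_vertexE j x p :
  f j x p = own_weight j p * x p + (1 - own_weight j p) * x (u j p).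
Proof.
rewrite /f /phi_vertex /own_weight; have [->|nj1] := eqVneq j v1.
  by rewrite /phi_1 sum_fbasis.
have [->|nj2] := eqVneq j v2.
  by rewrite /phi_2 sum_fbasis /fdual; case: hdata => -> _ _; ring.
rewrite /phi_ge3 mul0r add0r subr0 mul1r sum_ffunE (bigD1 (u j p)) //=.
rewrite [X in _ + X]big1.
  by rewrite addr0 !ffunE sum_fbasis eqxx /GRing.scale /= mulr1.
by move=> q nq; rewrite !ffunE sum_fbasis (negPf nq) /GRing.scale /= mulr0.
Qed.

Lemma phi_vertex_linear j : linear (f j).
Proof.
move=> k x y; apply/ffunP=> p; rewrite !ffunE !phi_vertexE !ffunE /GRing.scale /=.
ring.
Qed.

Lemma phi_vertex1 j : f j 1 = 1.
Proof. by apply/ffunP=> p; rewrite phi_vertexE !ffunE; ring. Qed.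

(** Off the cycle, [u j] is idempotent. On it, if [u p != p], the weights at [p] and [u p] add up to
    1, so [f (f x) - f x] at [p] is [- a p * (1 - a p) * (x p - x (u (u p)))], which the data make
    zero. *)
Lemma phi_vertex_idem j x : f j (f j x) = f j x.
Proof.
case: hdata => u12 uidem ha; apply/ffunP => p; rewrite !phi_vertexE.
have [jv|] := boolP ((j == v1) || (j == v2)); last first.
  rewrite negb_or => /andP[n1 n2].
  by rewrite /own_weight (negPf n1) (negPf n2) (uidem _ n1 n2); ring.
have uj : u j =1 u v1 by case/orP: jv => /eqP-> // q; rewrite u12.
rewrite !uj; have [h0 h1 h2] := ha p.
have [e|ne] := eqVneq (u v1 p) p; first by rewrite !e; ring.
have au : a (u v1 p) = 1 - a p by rewrite -(h1 ne); ring.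
have eq0 : a p * (1 - a p) * (x p - x (u v1 (u v1 p))) = 0.
  have [->|ne2] := eqVneq (u v1 (u v1 p)) p; first by ring.
  by case: (h2 ne ne2) => ->; ring.
apply/eqP; rewrite -subr_eq0 -oppr_eq0; apply/eqP; rewrite -[RHS]eq0.
rewrite /own_weight au; case/orP: jv => /eqP->;
  rewrite ?eqxx ?[v2 == v1]eq_sym ?(negPf n12); ring.
Qed.

Lemma phi_vertexM j x y :
  j != v1 -> j != v2 -> f j (x * y) = f j x * f j y.
Proof.
move=> n1 n2; apply/ffunP=> p.
by rewrite !(phi_vertexE, ffunE) /own_weight (negPf n1) (negPf n2); ring.
Qed.

Section CyclePair.
Variables j k : vertex G.
Hypothesis jk : (j = v1 /\ k = v2) \/ (j = v2 /\ k = v1).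

Let ukj : u k =1 u j.
Proof. by case: hdata => u12 _ _ p; case: jk => -[-> ->]; rewrite u12. Qed.

Let weightD p : own_weight k p = 1 - own_weight j p.
Proof.
rewrite /own_weight; case: jk => -[-> ->];
  rewrite !eqxx ?[v2 == v1]eq_sym ?(negPf n12) //; ring.
Qed.

(** With [c] the weight of [j], [f j] fails to be multiplicative by [c * (1 - c) * (x p - x (u j p))
    * (y p - y (u j p))], exactly the term of the path from [j] through [k] back to [j]. *)
Lemma cycle_factor_loop x y :
  f j x * f j y + (x - f k x) * (y - f j y) = f j (x * y).
Proof.
apply/ffunP=> p; rewrite !(phi_vertexE, ffunE) ukj weightD; ring.
Qed.

(** Because the weights of [j] and [k] are complementary, the mixed products [x p * y (u j p)] and
    [x (u j p) * y p] cancel. *)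
Lemma cycle_factor_arrow x y :
  (x - f j x) * f j y + f k x * (y - f j y) = x * y - f j (x * y).
Proof.
apply/ffunP=> p; rewrite !(phi_vertexE, ffunE) ukj weightD; ring.
Qed.

End CyclePair.

(** At [p] the product has the factor [1 - own_weight k p], which vanishes only in the two listed
    cases. *)
Lemma mul_corrections_eq0P k j :
  j != v1 -> j != v2 ->
  (forall x y, (x - f k x) * (y - f j y) = 0) <->
  (forall p, u k p != p -> u j p != p ->
     (k = v1 /\ a p = 1) \/ (k = v2 /\ a p = 0)).
Proof.
move=> n1 n2.
have prodE x y p : ((x - f k x) * (y - f j y)) p =
    (1 - own_weight k p) * ((x p - x (u k p)) * (y p - y (u j p))).
  by rewrite !(phi_vertexE, ffunE) /own_weight (negPf n1) (negPf n2); ring.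
split=> [h p nkp njp|h x y].
  (* On [f_p] both coordinate differences equal 1, leaving only the weight. *)
  have /ffunP/(_ p) := h (fbasis K p) (fbasis K p).
  rewrite prodE !ffunE eqxx ![p == _]eq_sym (negPf nkp) (negPf njp) subr0 !mulr1.
  rewrite /own_weight; have [->|_] := eqVneq k v1; first by move/subr0_eq; left.
  have [->|_] := eqVneq k v2; last by rewrite subr0 => /eqP; rewrite oner_eq0.
  by rewrite opprB addrC subrK; right.
apply/ffunP=> p; rewrite prodE ffunE.
have [->|nkp] := eqVneq (u k p) p; first by ring.
have [->|njp] := eqVneq (u j p) p; first by ring.
rewrite /own_weight; case: (h p nkp njp) => -[-> ->]; rewrite ?eqxx; first by ring.
by rewrite eq_sym (negPf n12); ring.
Qed.

End VertexMaps.

(** * Factorizability and the condition on the data *)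

Theorem theorem4p6 (K : fieldType) (m : nat) (G : quiver)
    (v1 v2 : vertex G) (al1 al2 : arrow G)
    (u : vertex G -> 'I_m -> 'I_m) (a : 'I_m -> K)
    (hmult : no_multiple_arrows G) (hloops : unique_loops G)
    (hconn : connected_quiver G) (hrank : reduced_rank G = 1%N)
    (hcycle : two_cycle v1 v2 al1 al2) (hdata : is_data v1 v2 u a) :
  let phi : arrow G -> K ^^ m -> K ^^ m := phi_data v1 v2 al1 al2 u a in
  [/\ representation phi, splitted phi, unital phi & factorizable phi] <->
  (forall al : arrow G, al != al1 -> al != al2 -> ~~ is_loop al ->
   forall p : 'I_m, u (src al) p != p -> u (tgt al) p != p ->
     (src al = v1 /\ a p = 1) \/ (src al = v2 /\ a p = 0)).
Proof.
move=> phi; have hrank1 : (reduced_rank G <= 1)%N by rewrite hrank.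
have [n12] := hcycle.
rewrite !inE => /andP[/eqP s1 /eqP t1] /andP[/eqP s2 /eqP t2].
have nal1 : ~~ is_loop al1 by rewrite /is_loop s1 t1.
have nal2 : ~~ is_loop al2 by rewrite /is_loop s2 t2 eq_sym.
have [inn inn_spec] := fin_all_exists (incoming_exists hconn hrank1 hcycle).
have loop_exists (j : vertex G) : exists be, tgt be = j /\ is_loop be.
  have /eqP/cards1P[be /setP/(_ be)] := hloops j.
  by rewrite !inE eqxx => /andP[/eqP sb /eqP tb]; exists be;
    rewrite /is_loop sb tb.
have [lp lp_spec] := fin_all_exists loop_exists.
have innE al : ~~ is_loop al -> al = inn (tgt al).
  by move=> nal; case: (inn_spec (tgt al)) => ? ?; apply: eq_incoming.
have incomingE j al : (tgt al == j) = (al == lp j) || (al == inn j).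
  have [tl ll] := lp_spec j; have [ti ni] := inn_spec j.
  apply/eqP/orP=> [tj|[]/eqP-> //].
  have [lal|nal] := boolP (is_loop al); [left|right]; last first.
    by rewrite {1}(innE _ nal) tj.
  by apply/eqP/eq_loop => //; rewrite tl.
have src_lp j : src (lp j) = j by have [tj /eqP->] := lp_spec j.
have src_inn j : src (inn j) != j by have [tj] := inn_spec j; rewrite /is_loop tj.
have inn1 : inn v1 = al2 by rewrite -t2 -innE.
have inn2 : inn v2 = al1 by rewrite -t1 -innE.
pose f := phi_vertex v1 v2 u a.
have phi_lp j x : phi (lp j) x = f j x.
  by have [tl ll] := lp_spec j; rewrite /phi /phi_data ll tl.
have phi_inn j x : phi (inn j) x = x - f j x.
  have [ti ni] := inn_spec j; rewrite /phi /phi_data (negPf ni) ti.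
  (* The explicit formulas for [al1] and [al2] also give [Id - phi_j] at their targets. *)
  have [e1|_] := eqVneq (inn j) al1.
    have -> : j = v2 by rewrite -ti e1 t1.
    apply/ffunP=> p; rewrite /phi_al1 sum_fbasis !ffunE phi_vertexE // /own_weight.
    by rewrite eq_sym (negPf n12) eqxx /fdual; case: hdata => -> _ _; ring.
  have [e2|//] := eqVneq (inn j) al2.
  have -> : j = v1 by rewrite -ti e2 t2.
  apply/ffunP=> p; rewrite /phi_al2 sum_fbasis !ffunE phi_vertexE // /own_weight.
  by rewrite eqxx /fdual; ring.
have flin j : linear (f j) := phi_vertex_linear hdata j.
have fM j x y : j != v1 -> j != v2 -> f j (x * y) = f j x * f j y.
  exact: phi_vertexM.
have fB j : {morph f j : x y / x - y}.
  by move=> x y; rewrite addrC -scaleN1r flin scaleN1r addrC.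
have hrep : representation phi.
  move=> al k x y; have /esym := incomingE (tgt al) al; rewrite eqxx.
  case/orP=> /eqP->; rewrite !(phi_lp, phi_inn) flin //.
  by rewrite scalerBr opprD addrACA.
have hsplit : splitted phi.
  exact: (splitted_idem incomingE src_lp src_inn phi_lp phi_inn fB
           (phi_vertex_idem n12 hdata)).
have hunit : unital phi.
  exact: (unital_fix incomingE src_lp src_inn phi_lp phi_inn (phi_vertex1 hdata)).
have hfactP := factorizableP incomingE src_lp src_inn phi_lp phi_inn.
split=> [[_ _ _ /hfactP hf] al n1 n2 nal|h].
  have tal1 : tgt al != v1.
    by apply: contraNneq n2 => e; rewrite (innE _ nal) e inn1.
  have tal2 : tgt al != v2.
    by apply: contraNneq n1 => e; rewrite (innE _ nal) e inn2.
  apply/(mul_corrections_eq0P n12 hdata (src al) tal1 tal2) => x y.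
  (* Only the two paths combining [al] with a loop go from [src al] to [tgt al]. *)
  have := hf (src al) (tgt al) x y; rewrite -(innE _ nal) eqxx.
  rewrite [tgt al == _]eq_sym [src al == tgt al](negPf nal) (negPf (src_inn _)).
  rewrite !mulr0n !mulr1n !add0r addr0.
  rewrite fM // => e.
  by rewrite (mul_correctionsE _ _ (f (tgt al) x)) e subrr.
split=> //; apply/hfactP => i j x y.
have pairE k : (j = v1 /\ k = v2) \/ (j = v2 /\ k = v1) ->
    src (inn j) = k /\ src (inn k) = j.
  by case=> -[-> ->]; rewrite inn1 inn2.
have [jv|] := boolP ((j == v1) || (j == v2)).
  have [k jk] : exists k, (j = v1 /\ k = v2) \/ (j = v2 /\ k = v1).
    by case/orP: jv => /eqP->; [exists v2; left|exists v1; right].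
  have [ej ek] := pairE _ jk.
  have := cycle_factor_loop n12 hdata jk x y.
  have := cycle_factor_arrow n12 hdata jk x y.
  rewrite -/f ej ek => <- <-.
  (* The loop identity counts when [i = j], the arrow identity when [i = k]. *)
  by rewrite !mulrnDl [X in _ + X = _]addrC addrACA.
rewrite negb_or => /andP[n1 n2].
have T0 : (x - f (src (inn j)) x) * (y - f j y) = 0.
  apply: (mul_corrections_eq0P n12 hdata _ n1 n2).2 => p.
  have [tj nj] := inn_spec j; rewrite -{2}tj; apply: h => //.
    by apply: contraNneq n2 => e; rewrite -tj e t1.
  by apply: contraNneq n1 => e; rewrite -tj e t2.
(* [T0] kills the path with two non-loop arrows and, through [mul_correctionsE], the defect of the
   arrow identity. *)
rewrite T0 mul0rn addr0 fM // -addrA -mulrnDl.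
congr (_ + _ *+ _); apply/eqP; rewrite -subr_eq0 -[_ == 0]oppr_eq0 opprB.
by rewrite -mul_correctionsE T0.
Qed.
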